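(* Let $\Lambda$ be an arbitrary ring and $f:A\twoheadrightarrow B$ an epimorphism of $\Lambda$-modules. If $\underline{f}$ is a normal epimorphism in the stable category $\Lambda\text{-}\underline{\mathrm{Mod}}$, then every homomorphism $\alpha:\mathrm{Ker}\, f\to P$ with $P$ projective is $f$-split.
   Context: Rings are associative with identity; modules are left modules. The stable category $\Lambda\text{-}\underline{\mathrm{Mod}}$ has all left $\Lambda$-modules as objects; its morphisms are classes $\underline{f}$ of $\Lambda$-homomorphisms $f$, where $f$ and $g$ are equivalent if $f-g$ factors through a projective module. An epimorphism in a category is normal if it is a cokernel of some morphism. Let $f:A\twoheadrightarrow B$ be an epimorphism of $\Lambda$-modules, with short exact sequence $[f]:\ 0\to\mathrm{Ker}\, f\xrightarrow{i}A\xrightarrow{f}B\to 0$. For a homomorphism $\alpha:\mathrm{Ker}\, f\to X$, let $\alpha[f]:\ 0\to X\to D\to B\to 0$ be the short exact sequence obtained from $[f]$ by pushout along $\alpha$. We say (terminology introduced here) that $\alpha$ is $f$-split if the following conditions, which are equivalent to each other for every $\alpha$, hold: (i) $\alpha[f]$ splits; (ii) any chain map from $[f]$ to a short exact sequence $0\to X\to Y\to Z\to 0$ with left component $\alpha$ is null-homotopic; (iii) for any exact sequence $X\xrightarrow{\delta}Y\xrightarrow{\gamma}Z\to 0$ and any homomorphisms $g:A\to Y$, $h:B\to Z$ with $gi=\delta\alpha$ and $hf=\gamma g$, there exist $s:B\to Y$ and $s':A\to X$ such that $g=sf+\delta s'$ and $h=\gamma s$. *)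

(* Defs.v *)
From HB Require Import structures.
From mathcomp Require Import all_boot all_algebra.
From mathcomp Require Import boolp.

Set Implicit Arguments.
Unset Strict Implicit.
Unset Printing Implicit Defensive.

Import GRing.Theory.
Local Open Scope ring_scope.
Local Open Scope quotient_scope.

(** * Categories with zero morphisms *)

Record zcategory := ZCategory {
  obj :> Type;
  hom : obj -> obj -> Type;
  idm : forall a, hom a a;
  comp : forall a b c, hom b c -> hom a b -> hom a c;
  zerom : forall a b, hom a b;
  compA : forall a b c d (h : hom c d) (g : hom b c) (f : hom a b),
    comp h (comp g f) = comp (comp h g) f;
  comp1m : forall a b (f : hom a b), comp (idm b) f = f;
  compm1 : forall a b (f : hom a b), comp f (idm a) = f;
  comp0m : forall a b c (f : hom a b), comp (zerom b c) f = zerom a c;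
  compm0 : forall a b c (g : hom b c), comp g (zerom a b) = zerom a c
}.

Definition epi (C : zcategory) (a b : C) (f : hom a b) : Prop :=
  forall (c : C) (g h : hom b c), comp g f = comp h f -> g = h.

Definition is_cokernel (C : zcategory) (k a b : C) (u : hom k a)
    (f : hom a b) : Prop :=
  comp f u = zerom k b /\
  forall (c : C) (g : hom a c), comp g u = zerom k c ->
    exists! h : hom b c, comp h f = g.

Definition normal_epi (C : zcategory) (a b : C) (f : hom a b) : Prop :=
  epi f /\ exists (k : C) (u : hom k a), is_cokernel u f.

(** * Modules over an arbitrary, possibly zero, ring *)

Section Modules.
Variable R : pzRingType.

Definition surj (A B : lmodType R) (f : {linear A -> B}) : Prop :=
  forall b, exists a, f a = b.

Definition projective (P : lmodType R) : Prop :=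
  forall (M N : lmodType R) (e : {linear M -> N}) (g : {linear P -> N}),
    surj e -> exists h : {linear P -> M}, forall x, e (h x) = g x.

Definition right_exact (X Y Z : lmodType R) (d : {linear X -> Y})
    (g : {linear Y -> Z}) : Prop :=
  (forall y, g y = 0 <-> exists x, d x = y) /\ surj g.

Definition short_exact (X Y Z : lmodType R) (d : {linear X -> Y})
    (g : {linear Y -> Z}) : Prop :=
  injective d /\ right_exact d g.

Section Kernel.
Variables (A B : lmodType R) (f : {linear A -> B}).

Definition ker_pred : {pred A} := [pred x | f x == 0].

Fact ker_submod_closed : submod_closed ker_pred.
Proof.
split=> [|a u v]; first by rewrite inE raddf0.
by rewrite !inE => /eqP fu /eqP fv; rewrite linearP fu fv scaler0 addr0.
Qed.

HB.instance Definition _ :=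
  GRing.isSubmodClosed.Build R A ker_pred ker_submod_closed.

Record Ker := InKer { ker_val : A; ker_valP : ker_val \in ker_pred }.

HB.instance Definition _ := [isSub of Ker for ker_val].
HB.instance Definition _ := [Choice of Ker by <:].
HB.instance Definition _ := [SubChoice_isSubLmodule of Ker by <:].

Definition ker_incl : {linear Ker -> A} := \val.
#[global] Arguments ker_incl : simpl never.

Lemma ker_inclE k : f (ker_incl k) = 0.
Proof. exact: eqP (ker_valP k). Qed.

End Kernel.

Section QuotientModule.
Variables (V : lmodType R) (W : submodClosed V).

(* [W] with the closure under opposites that [Quotient.quot] requires. *)
Definition zpred : {pred V} := [pred v | v \in W].

HB.instance Definition _ :=
  GRing.isSubmodClosed.Build R V zpred (submodClosedP W).

Definition quot_mod : Type := Quotient.quot zpred.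
HB.instance Definition _ := GRing.Zmodule.on quot_mod.

Definition quot_scale (a : R) (x : quot_mod) : quot_mod :=
  \pi_(Quotient.quot zpred) (a *: repr x).

Let pi (v : V) : quot_mod := \pi_(Quotient.quot zpred) v.

Fact pi_eqP (u v : V) : pi u = pi v <-> u - v \in W.
Proof.
rewrite -[u - v \in W]/(u - v \in zpred) Quotient.idealrBE.
by split=> /eqP.
Qed.

Fact pi_scale a v : quot_scale a (pi v) = pi (a *: v).
Proof.
by apply/pi_eqP; rewrite -scalerBr rpredZ //; apply/pi_eqP; rewrite /pi reprK.
Qed.

Fact piD u v : pi (u + v) = pi u + pi v.
Proof. exact: (Quotient.pi_add zpred). Qed.

Let pi_repr (x : quot_mod) : x = pi (repr x).
Proof. by rewrite /pi reprK. Qed.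

Fact quot_scaleA a b x :
  quot_scale a (quot_scale b x) = quot_scale (a * b) x.
Proof. by rewrite (pi_repr x) !pi_scale scalerA. Qed.
Fact quot_scale1 : left_id 1 quot_scale.
Proof. by move=> x; rewrite (pi_repr x) !pi_scale scale1r. Qed.
Fact quot_scaleDr : right_distributive quot_scale +%R.
Proof.
by move=> a x y; rewrite (pi_repr x) (pi_repr y) -piD !pi_scale -piD scalerDr.
Qed.
Fact quot_scaleDl x : {morph quot_scale^~ x : a b / a + b}.
Proof. by move=> a b /=; rewrite (pi_repr x) !pi_scale -piD scalerDl. Qed.

HB.instance Definition _ := GRing.Zmodule_isLmodule.Build R quot_mod
  quot_scaleA quot_scale1 quot_scaleDr quot_scaleDl.

Definition quot_proj_fun (v : V) : quot_mod := pi v.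

Fact quot_proj_linear : linear quot_proj_fun.
Proof.
by move=> a u v; rewrite /quot_proj_fun piD -pi_scale.
Qed.

HB.instance Definition _ :=
  GRing.isLinear.Build R V quot_mod _ quot_proj_fun quot_proj_linear.

Definition quot_proj : {linear V -> quot_mod} := quot_proj_fun.
#[global] Arguments quot_proj : simpl never.

Lemma quot_projP u v : quot_proj u = quot_proj v <-> u - v \in W.
Proof. exact: pi_eqP. Qed.

Lemma quot_proj_surj : surj quot_proj.
Proof. by move=> x; exists (repr x); rewrite [RHS]pi_repr. Qed.

Section Lift.
Variables (U : lmodType R) (g : {linear V -> U}).
Hypothesis gW : forall v, v \in W -> g v = 0.

Definition quot_lift_fun (x : quot_mod) : U := g (repr x).

Fact quot_lift_projE v : quot_lift_fun (quot_proj v) = g v.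
Proof.
rewrite /quot_lift_fun; apply/eqP; rewrite -subr_eq0 -raddfB /= gW //.
apply/quot_projP.
by rewrite [RHS](pi_repr (quot_proj v)).
Qed.

Fact quot_lift_linear : linear quot_lift_fun.
Proof.
move=> a x y; case: (quot_proj_surj x) (quot_proj_surj y) => u <- [v <-].
by rewrite -linearP !quot_lift_projE linearP.
Qed.

HB.instance Definition _ :=
  GRing.isLinear.Build R quot_mod U _ quot_lift_fun quot_lift_linear.

Definition quot_lift : {linear quot_mod -> U} := quot_lift_fun.

Lemma quot_liftE v : quot_lift (quot_proj v) = g v.
Proof. exact: quot_lift_projE. Qed.

End Lift.
End QuotientModule.

(** * The short exact sequence [alpha[f] : 0 -> X -> D -> B -> 0] *)

Section Pushout.
Variables (A B X : lmodType R) (f : {linear A -> B}).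
Variable alpha : {linear Ker f -> X}.

Definition po_rel : {pred X * A} :=
  [pred p | `[< exists k : Ker f, p = (alpha k, - ker_incl f k) >]].

Fact po_rel_submod_closed : submod_closed po_rel.
Proof.
split=> [|a u v].
  by rewrite inE; apply/asboolP; exists 0; rewrite !raddf0.
rewrite !inE => /asboolP[k ->] /asboolP[l ->]; apply/asboolP.
by exists (a *: k + l); rewrite !linearP; congr pair; rewrite /= opprD scalerN.
Qed.

HB.instance Definition _ :=
  GRing.isSubmodClosed.Build R (X * A)%type po_rel po_rel_submod_closed.

Definition po_mod : lmodType R := quot_mod po_rel.

Definition inX_fun (x : X) : X * A := (x, 0).
Fact inX_linear : linear inX_fun.
Proof. by move=> a x y; congr pair; rewrite /= scaler0 addr0. Qed.
HB.instance Definition _ :=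
  GRing.isLinear.Build R X (X * A)%type _ inX_fun inX_linear.

Definition inA_fun (x : A) : X * A := (0, x).
Fact inA_linear : linear inA_fun.
Proof. by move=> a x y; congr pair; rewrite /= scaler0 addr0. Qed.
HB.instance Definition _ :=
  GRing.isLinear.Build R A (X * A)%type _ inA_fun inA_linear.

Definition po_inl : {linear X -> po_mod} := quot_proj po_rel \o inX_fun.
#[global] Arguments po_inl : simpl never.
Definition po_inr : {linear A -> po_mod} := quot_proj po_rel \o inA_fun.
#[global] Arguments po_inr : simpl never.

Let f_snd : {linear (X * A)%type -> B} := f \o snd.

Fact f_snd_po_rel p : p \in po_rel -> f_snd p = 0.
Proof.
rewrite inE => /asboolP[k ->]; rewrite -[LHS]/(f (- ker_incl f k)) raddfN.
by rewrite [X in - X](ker_inclE k) oppr0.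
Qed.

Definition po_epi : {linear po_mod -> B} := quot_lift f_snd_po_rel.
#[global] Arguments po_epi : simpl never.

(* The sequence [0 -> X -> po_mod -> B -> 0] splits; see [f_splitP] for two
   characterizations. *)
Definition f_split : Prop :=
  exists s : {linear B -> po_mod}, forall b, po_epi (s b) = b.

(* Chain maps [(alpha, g, h)] from [0 -> Ker f -> A -> B -> 0] to a short exact
   sequence are null-homotopic. *)
Definition chain_map_split : Prop :=
  forall (Y Z : lmodType R) (d : {linear X -> Y}) (c : {linear Y -> Z})
      (g : {linear A -> Y}) (h : {linear B -> Z}),
    short_exact d c ->
    (forall k, g (ker_incl f k) = d (alpha k)) ->
    (forall a, h (f a) = c (g a)) ->
  exists (s : {linear B -> Y}) (s' : {linear A -> X}),
    [/\ forall k, alpha k = s' (ker_incl f k),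
        forall a, g a = s (f a) + d (s' a)
      & forall b, h b = c (s b)].

Definition right_exact_split : Prop :=
  forall (Y Z : lmodType R) (d : {linear X -> Y}) (c : {linear Y -> Z})
      (g : {linear A -> Y}) (h : {linear B -> Z}),
    right_exact d c ->
    (forall k, g (ker_incl f k) = d (alpha k)) ->
    (forall a, h (f a) = c (g a)) ->
  exists (s : {linear B -> Y}) (s' : {linear A -> X}),
    (forall a, g a = s (f a) + d (s' a)) /\ (forall b, h b = c (s b)).

Lemma po_square k : po_inr (ker_incl f k) = po_inl (alpha k).
Proof.
apply/quot_projP; rewrite inE; apply/asboolP; exists (- k).
by congr pair; rewrite /= !raddfN /= ?sub0r ?opprK ?subr0.
Qed.

Lemma po_epi_inl x : po_epi (po_inl x) = 0.
Proof.
by rewrite [LHS](quot_liftE f_snd_po_rel (x, 0)) -[LHS]/(f 0) raddf0.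
Qed.

Lemma po_epi_inr a : po_epi (po_inr a) = f a.
Proof. exact: (quot_liftE f_snd_po_rel (0, a)). Qed.

Lemma po_modP (y : po_mod) : exists x a, y = po_inl x + po_inr a.
Proof.
have [[x a] <-] := quot_proj_surj y; exists x, a.
rewrite (_ : (x, a) = (x, 0) + (0, a)) ?raddfD //.
by congr pair; rewrite /= ?addr0 ?add0r.
Qed.

(* [po_mod] is the pushout of [alpha] and the inclusion of [Ker f]. *)
Lemma po_universal (Y : lmodType R) (d : {linear X -> Y})
    (g : {linear A -> Y}) :
  (forall k, g (ker_incl f k) = d (alpha k)) ->
  exists2 h : {linear po_mod -> Y},
    (forall x, h (po_inl x) = d x) /\ (forall a, h (po_inr a) = g a) &
    forall h' : {linear po_mod -> Y},
      (forall x, h' (po_inl x) = d x) -> (forall a, h' (po_inr a) = g a) ->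
      h' =1 h.
Proof.
move=> gd; pose m : {linear (X * A)%type -> Y} := (d \o fst) \+ (g \o snd).
have mW p : p \in po_rel -> m p = 0.
  by rewrite inE => /asboolP[k ->]; rewrite /= raddfN /= gd subrr.
have E1 x : quot_lift mW (po_inl x) = d x.
  by rewrite [LHS](quot_liftE mW (x, 0)) /= raddf0 addr0.
have E2 a : quot_lift mW (po_inr a) = g a.
  by rewrite [LHS](quot_liftE mW (0, a)) /= raddf0 add0r.
exists (quot_lift mW) => // h' h1 h2 y; have [x [a ->]] := po_modP y.
by rewrite !linearD h1 h2 E1 E2.
Qed.

Lemma po_exact : surj f -> short_exact po_inl po_epi.
Proof.
move=> f_surj; split; last split.
- move=> x y /quot_projP; rewrite inE => /asboolP[k /= [/eqP + kE]].
  have k0 : ker_incl f k = 0 by apply: oppr_inj; rewrite -kE subr0 oppr0.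
  have -> : k = 0 by apply: val_inj; rewrite [LHS]k0 raddf0.
  by rewrite raddf0 subr_eq0 => /eqP.
- move=> y; split=> [|[x <-]]; last exact: po_epi_inl.
  have [x [a ->]] := po_modP y.
  rewrite linearD po_epi_inl po_epi_inr add0r => /eqP fa.
  exists (x + alpha (InKer fa)).
  by rewrite linearD -po_square.
- by move=> b; have [a <-] := f_surj b; exists (po_inr a); apply: po_epi_inr.
Qed.

End Pushout.

Lemma mono_factor (A B Y : lmodType R) (d : {linear A -> B})
    (g : {linear Y -> B}) :
  injective d -> (forall y, exists a, d a = g y) ->
  exists h : {linear Y -> A}, forall y, d (h y) = g y.
Proof.
move=> d_inj im; pose h y := projT1 (cid (im y)).
have dh y : d (h y) = g y by rewrite /h; case: cid.
have hl : linear h by move=> a x y; apply: d_inj; rewrite linearP !dh linearP.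
pose hM := GRing.isLinear.Build R Y A _ h hl.
pose H : {linear Y -> A} := HB.pack h hM.
by exists H.
Qed.

Lemma epi_factor (A B Y : lmodType R) (f : {linear A -> B})
    (g : {linear A -> Y}) :
  surj f -> (forall a, f a = 0 -> g a = 0) ->
  exists h : {linear B -> Y}, forall a, h (f a) = g a.
Proof.
move=> f_surj kf; pose h b := g (projT1 (cid (f_surj b))).
have hf a : h (f a) = g a.
  rewrite /h; case: cid => a' /= fa.
  by apply/eqP; rewrite -subr_eq0 -linearB kf // linearB fa subrr.
have hl : linear h.
  move=> a x y; case: (f_surj x) (f_surj y) => u <- [v <-].
  by rewrite -linearP !hf linearP.
pose hM := GRing.isLinear.Build R B Y _ h hl.
pose H : {linear B -> Y} := HB.pack h hM.
by exists H.
Qed.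

Lemma f_splitP (A B X : lmodType R) (f : {linear A -> B})
    (alpha : {linear Ker f -> X}) : surj f ->
  (f_split alpha <-> chain_map_split alpha) /\
  (f_split alpha <-> right_exact_split alpha).
Proof.
move=> f_surj; have [inlI [po_ker po_surj]] := po_exact alpha f_surj.
have i_iii : f_split alpha -> right_exact_split alpha.
  move=> [s sP] Y Z d c g h [cd_ex c_surj] gd hf.
  pose t : {linear A -> po_mod alpha} := po_inr alpha \- (s \o f).
  have [|s' s'E] := @mono_factor _ _ _ (po_inl alpha) t inlI.
    move=> a; apply/po_ker.
    by rewrite [LHS]linearB [X in _ - X]sP po_epi_inr subrr.
  have s'K k : s' (ker_incl f k) = alpha k.
    apply: inlI; rewrite s'E -po_square /t /=.
    by rewrite ker_inclE raddf0 subr0.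
  pose u : {linear A -> Y} := g \- (d \o s').
  have [a fa|r rf] := @epi_factor _ _ _ f u f_surj.
    have fa' : a \in ker_pred f by rewrite inE fa.
    by have := gd (InKer fa'); rewrite /u /= -s'K /= => ->; rewrite subrr.
  exists r, s'; split=> [a|b]; first by rewrite rf /u /= subrK.
  have [a <-] := f_surj b; rewrite rf hf /u /= linearB.
  by rewrite (_ : c (d _) = 0) ?subr0 //; apply/cd_ex; exists (s' a).
have iii_ii : right_exact_split alpha -> chain_map_split alpha.
  move=> iii Y Z d c g h [d_inj ex] gd hf.
  have [s [s' [gE hE]]] := iii _ _ _ _ _ _ ex gd hf.
  exists s, s'; split=> // k; apply: d_inj.
  by rewrite -gd gE ker_inclE raddf0 add0r.
have ii_i : chain_map_split alpha -> f_split alpha.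
  move=> ii.
  have [| | |s [s' [_ _ sE]]] :=
      ii _ _ (po_inl alpha) (po_epi alpha) (po_inr alpha) (@idfun B).
  - exact: po_exact.
  - exact: po_square.
  - by move=> a; rewrite po_epi_inr.
  by exists s => b; rewrite -sE.
by split; split; auto.
Qed.

(** * The stable category *)

Definition factors_through_projective (A B : lmodType R)
    (f : {linear A -> B}) : Prop :=
  exists2 P : lmodType R, projective P &
  exists (u : {linear A -> P}) (v : {linear P -> B}),
    forall x, f x = v (u x).

Lemma projective_prod (P Q : lmodType R) :
  projective P -> projective Q -> projective (P * Q)%type.
Proof.
move=> Pp Qp M N e g e_surj.
pose jP x : P * Q := (x, 0); pose jQ y : P * Q := (0, y).
have jPl : linear jP by move=> a x y; congr pair; rewrite /= scaler0 addr0.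
have jQl : linear jQ by move=> a x y; congr pair; rewrite /= scaler0 addr0.
pose JP : {linear P -> (P * Q)%type} :=
  HB.pack jP (GRing.isLinear.Build R P (P * Q)%type _ jP jPl).
pose JQ : {linear Q -> (P * Q)%type} :=
  HB.pack jQ (GRing.isLinear.Build R Q (P * Q)%type _ jQ jQl).
have [h hE] := Pp _ _ e (g \o JP) e_surj.
have [k kE] := Qp _ _ e (g \o JQ) e_surj.
exists ((h \o fst) \+ (k \o snd)) => -[x y] /=.
rewrite linearD hE kE /=.
rewrite -[LHS](linearD g); congr (g _).
by congr pair; rewrite /= ?addr0 ?add0r.
Qed.

Lemma projective0 : projective 'rV[R]_0.
Proof.
move=> M N e g _; exists \0 => x.
by rewrite (_ : x = 0) ?raddf0 //; apply/rowP; case.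
Qed.

(* The homomorphisms carry no choice structure, which quotients require:
   [{classic _}] provides one. *)
Section StableHom.
Variables A B : lmodType R.

Definition stable_rel : rel {classic {linear A -> B}} :=
  fun f g => `[< factors_through_projective
                   ((f : {linear A -> B}) \- (g : {linear A -> B})) >].

Fact stable_rel_equiv : equiv_class_of stable_rel.
Proof.
have half (f g : {classic {linear A -> B}}) :
    stable_rel f g -> stable_rel g f.
  move=> /asboolP[P Pp [u [v E]]]; apply/asboolP; exists P => //.
  by exists u, (\- v) => x /=; rewrite -E /= opprB.
split=> [f|f g|g f h].
- apply/asboolP; exists 'rV[R]_0; first exact: projective0.
  by exists \0, \0 => x /=; rewrite subrr.
- by apply/idP/idP; apply: half.
- move=> /asboolP[P Pp [u [v E]]] /asboolP[Q Qp [w [z F]]]; apply/asboolP.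
  exists (P * Q)%type; first exact: projective_prod.
  pose j x : P * Q := (u x, w x).
  have jl : linear j by move=> a x y; congr pair; rewrite /= linearP.
  pose J : {linear A -> (P * Q)%type} :=
    HB.pack j (GRing.isLinear.Build R A (P * Q)%type _ j jl).
  exists J, ((v \o fst) \+ (z \o snd)) => x /=.
  by rewrite -E -F /= addrA subrK.
Qed.

Canonical stable_rel_equiv_rel := EquivRelPack stable_rel_equiv.
Canonical stable_rel_encModRel := defaultEncModRel stable_rel.

Definition stable_hom : Type := {eq_quot stable_rel}.

Definition stable_class (f : {linear A -> B}) : stable_hom :=
  \pi_{eq_quot stable_rel} (f : {classic {linear A -> B}}).

Definition stable_repr (f : stable_hom) : {linear A -> B} :=
  repr (f : {eq_quot stable_rel}).

Lemma stable_classP (f g : {linear A -> B}) :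
  stable_class f = stable_class g <-> factors_through_projective (f \- g).
Proof.
split=> [/eqmodP /asboolP //|fg].
by apply/eqmodP; apply/asboolP.
Qed.

Lemma stable_reprK f : stable_class (stable_repr f) = f.
Proof. exact: (@reprK _ {eq_quot stable_rel}). Qed.

End StableHom.

Definition stable_comp (A B C : lmodType R) (g : stable_hom B C)
    (f : stable_hom A B) : stable_hom A C :=
  stable_class (stable_repr g \o stable_repr f).

Lemma stable_class_ext (A B : lmodType R) (f g : {linear A -> B}) :
  f =1 g -> stable_class f = stable_class g.
Proof.
move=> fg; apply/stable_classP; exists 'rV[R]_0; first exact: projective0.
by exists \0, \0 => x /=; rewrite fg subrr.
Qed.

Lemma stable_compE (A B C : lmodType R) (g : {linear B -> C})
    (f : {linear A -> B}) :
  stable_comp (stable_class g) (stable_class f) = stable_class (g \o f).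
Proof.
rewrite /stable_comp; set g' := stable_repr _; set f' := stable_repr _.
have /stable_classP[P Pp [u [v E]]] : stable_class g' = stable_class g.
  exact: stable_reprK.
have /stable_classP[Q Qp [w [z F]]] : stable_class f' = stable_class f.
  exact: stable_reprK.
transitivity (stable_class (g \o f')); apply/stable_classP.
  by exists P => //; exists (u \o f'), v => x /=; rewrite -E.
exists Q => //; exists w, (g \o z) => x /=.
by rewrite -F /= raddfB.
Qed.

Fact stable_compA (A B C D : lmodType R) (h : stable_hom C D)
    (g : stable_hom B C) (f : stable_hom A B) :
  stable_comp h (stable_comp g f) = stable_comp (stable_comp h g) f.
Proof.
rewrite -(stable_reprK f) -(stable_reprK g) -(stable_reprK h) !stable_compE.
exact: stable_class_ext.
Qed.

Fact stable_comp1m (A B : lmodType R) (f : stable_hom A B) :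
  stable_comp (stable_class idfun) f = f.
Proof.
rewrite -(stable_reprK f) stable_compE; exact: stable_class_ext.
Qed.

Fact stable_compm1 (A B : lmodType R) (f : stable_hom A B) :
  stable_comp f (stable_class idfun) = f.
Proof.
rewrite -(stable_reprK f) stable_compE; exact: stable_class_ext.
Qed.

Fact stable_comp0m (A B C : lmodType R) (f : stable_hom A B) :
  stable_comp (stable_class \0 : stable_hom B C) f = stable_class \0.
Proof.
rewrite -(stable_reprK f) stable_compE; exact: stable_class_ext.
Qed.

Fact stable_compm0 (A B C : lmodType R) (g : stable_hom B C) :
  stable_comp g (stable_class \0 : stable_hom A B) = stable_class \0.
Proof.
rewrite -(stable_reprK g) stable_compE; apply: stable_class_ext => x /=.
by rewrite raddf0.
Qed.

Definition stable_category : zcategory :=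
  ZCategory stable_compA stable_comp1m stable_compm1
    stable_comp0m stable_compm0.

End Modules.

(* Main.v *)
(** Let [p : D -> B] be the epimorphism of the pushout sequence [alpha[f]] and
    [g : A -> D] the pushout map, and let [f] be a stable cokernel of [u].
    As [f u] factors through a projective, which lifts along [f], the map [u]
    may be chosen with [f u = 0]; then [g u] factors through [P], so
    [g = h f] stably for some [h : B -> D].  Hence [p h f = f], and [p h = 1]
    stably because [f] is epi.  So [1 - p h] factors through a projective,
    which lifts along [p], and this corrects [h] to an honest section of
    [p]. *)
Require Import Defs.
From mathcomp Require Import all_boot all_algebra.

Import GRing.Theory.
Local Open Scope ring_scope.

(** The projective middle term lifts along [p], so the lift of [f] is again stably zero. *)
Lemma factors_through_surj {R : pzRingType} {A B C : lmodType R}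
    {p : {linear A -> B}} {f : {linear C -> B}} :
  surj p -> factors_through_projective f ->
  exists t : {linear C -> A}, factors_through_projective t /\
    forall x, p (t x) = f x.
Proof.
move=> p_surj [Q Qproj [w [v fE]]].
have [l lE] := Qproj _ _ p v p_surj.
exists (l \o w); split=> [|x]; last by rewrite /= lE fE.
by exists Q => //; exists w, l.
Qed.

Lemma stable_section {R : pzRingType} {A B : lmodType R}
    {p : {linear A -> B}} {h : {linear B -> A}} :
  surj p -> stable_class (p \o h) = stable_class idfun ->
  exists s : {linear B -> A}, forall b, p (s b) = b.
Proof.
move=> p_surj /esym/stable_classP/(factors_through_surj p_surj)[t [_ tE]].
by exists (h \+ t) => b; rewrite /= linearD tE /= addrC subrK.
Qed.

(** Subtracting from [u] a stably zero lift of [f \o u] along [f] lands in [Ker f]. *)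
Lemma stable_zero_ker {R : pzRingType} {A B K : lmodType R}
    {f : {linear A -> B}} (u : {linear K -> A}) :
  surj f -> stable_class (f \o u) = stable_class \0 ->
  exists k : {linear K -> Ker f},
    stable_class u = stable_class (ker_incl f \o k).
Proof.
move=> f_surj /stable_classP/(factors_through_surj f_surj)[t [t_proj tE]].
have [||k kE] := @mono_factor _ _ _ _ (ker_incl f) (u \- t).
- exact: val_inj.
- move=> x; have fx : (u \- t) x \in ker_pred f.
    by rewrite inE /= linearB tE /= subr0 subrr.
  by exists (InKer fx).
exists k; apply/stable_classP.
case: t_proj => Q Qproj [w [v vwE]]; exists Q => //; exists w, v => x.
by rewrite -vwE -[LHS]/(u x - ker_incl f (k x)) kE subKr.
Qed.

Theorem proposition8p7 (Lambda : pzRingType) (A B : lmodType Lambda)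
    (f : {linear A -> B}) (f_epi : surj f)
    (f_normal : @normal_epi (stable_category Lambda) A B (stable_class f))
    (P : lmodType Lambda) (P_proj : projective P)
    (alpha : {linear Ker f -> P}) :
  f_split alpha.
Proof.
case: f_normal => f_sepi [K [u [/= fu0 f_coker]]].
have [_ [_ p_surj]] := po_exact alpha f_epi.
have [|k uE] := stable_zero_ker (stable_repr u) f_epi.
  by rewrite -stable_compE stable_reprK.
rewrite stable_reprK in uE.
have [|h [hf _]] := f_coker (po_mod alpha) (stable_class (po_inr alpha)).
  rewrite uE [LHS]stable_compE; apply/stable_classP.
  (* By the pushout square, [po_inr alpha] restricts on [Ker f] to a map through [P]. *)
  exists P => //; exists (alpha \o k), (po_inl alpha) => x.
  by rewrite -[RHS]po_square -[RHS]subr0.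
apply: (stable_section (h := stable_repr h) p_surj).
(* Cancelling [f] stably, it remains that [po_epi alpha \o po_inr alpha] is [f]. *)
apply: (f_sepi B) => /=.
rewrite -stable_compE stable_reprK -stable_compA hf !stable_compE.
by apply: stable_class_ext => x; apply: po_epi_inr.
Qed.
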